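(* There is an absolute constant $C>0$ such that the following holds. Let $f:\mathbb{R}^2\to\{-1,+1\}$ be a function that is constant on each cell $x+[0,1)^2$, $x\in\mathbb{Z}^2$. Then for arbitrarily large $R>0$ (that is, for every $R_0>0$ there is some $R>R_0$ for which this is true) there is a circular arc $I\subset\mathbb{R}^2$ of radius $R$ such that $$\left|\int_I f\right|\ge C\sqrt{R}.$$
   Context: A circular arc of radius $R$ is an arc (connected piece) of a circle of radius $R$ in the plane. The integral $\int_I f$ is taken with respect to arc length on $I$. ''Absolute constant'' means that $C$ does not depend on $f$ or $R$. *)

(* Defs.v *)
From mathcomp Require Import all_boot all_order all_algebra.
From mathcomp Require Import all_classical all_reals all_analysis.
Set Implicit Arguments.
Unset Strict Implicit.
Unset Printing Implicit Defensive.
Import Order.TTheory GRing.Theory Num.Theory.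
Import numFieldNormedType.Exports.
Local Open Scope classical_set_scope.
Local Open Scope ring_scope.

Definition unit_cell (R : realType) (m n : int) : set (R * R) :=
  [set p | (m%:~R <= p.1 < m%:~R + 1) && (n%:~R <= p.2 < n%:~R + 1)].

Definition cellwise_constant (R : realType) (f : R * R -> R) : Prop :=
  forall (m n : int) (p q : R * R),
    unit_cell m n p -> unit_cell m n q -> f p = f q.

Definition circle (R : realType) (c : R * R) (r : R) : set (R * R) :=
  [set p | (p.1 - c.1) ^+ 2 + (p.2 - c.2) ^+ 2 = r ^+ 2].

(* The whole circle counts as an arc; the topology is the product topology. *)
Definition circular_arc (R : realType) (c : R * R) (r : R) (I : set (R * R)) :
    Prop :=
  [/\ I !=set0, I `<=` circle c r & connected I].

(* For r > 0, the arc-length (unit speed) parametrization of [circle c r],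
   a bijection from [0, 2 pi r[ onto it. *)
Definition circle_param (R : realType) (c : R * R) (r s : R) : R * R :=
  (c.1 + r * cos (s / r), c.2 + r * sin (s / r)).

(* Arc length on [circle c r] is the image of Lebesgue measure on [0, 2 pi r[
   under [circle_param c r]; this is the integral of f over I, a subset of the
   circle, against it.  If I is an arc then its preimage is an interval, or the
   union of two when I passes through [circle_param c r 0]. *)
Definition arc_integral (R : realType) (c : R * R) (r : R) (I : set (R * R))
    (f : R * R -> R) : R :=
  \int[lebesgue_measure]_(s in `[0, 2 * pi * r[ `&` circle_param c r @^-1` I)
    f (circle_param c r s).

(* Main.v *)
From HB Require Import structures.
Require Import Defs.
From mathcomp Require Import all_boot all_order all_algebra.
From mathcomp Require Import all_classical all_reals all_analysis.
From mathcomp Require Import measurable_realfun zify ring lra.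
Import Order.TTheory GRing.Theory Num.Theory.
Import numFieldNormedType.Exports.
Local Open Scope classical_set_scope.
Local Open Scope ring_scope.

(**
A second moment argument over full circles.  Let F be f cut off to a large
square of side N, let Q_s be the rotation of the plane by the angle s, and let
u, v range over an n x n grid of spacing h > R0.  For u <> v the integral D of
f(c + Q_s (v - u)) over s in [0, 2 pi] is 1/r times the integral of f over the
circle with centre c and radius r = |v - u| > R0; if all these integrals were
smaller than C sqrt r, then D^2 < C^2 / r, and summing over u and v (where the
sum of 1/|v - u| is O(n^3 / h)) would bound the sum over u, v of the integral
over c of D^2 by about C^2 n^3 N^2 / h.

On the other hand, expanding the squares gives a double integral over angles
s, t of the sum over u, v of the integral over c of
F(c + Q_s (v - u)) F(c + Q_t (v - u)).  The translation of c by
Q_t u - Q_s v turns this sum into the integral over c of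
(sum over u of F(c + (Q_t - Q_s) u))^2.  So it is nonnegative for all s and t,
and it is at least n^4 N^2 / 4 when |s - t| is at most 1 / (8 h n), because
then all points c + (Q_t - Q_s) u lie in the same cell as soon as c is in the
middle half of a cell.  Hence the same quantity is at least of order
n^3 N^2 / h, a contradiction if C is small.
*)

(** * Lebesgue measure on the plane, and affine changes of variable *)

Section plane_measure.
Variable R : realType.
Local Notation mu := (@lebesgue_measure R).
Local Notation RT := (measurableTypeR R).

(* The sigma-finite structure that unification finds for [_ \x _] is the one of
   subprobability measures, hence a name for the product. *)
Definition leb2 : set (RT * RT) -> \bar R := (mu \x mu)%E.
HB.instance Definition _ := Measure.on leb2.

Lemma leb2E (A B : set RT) :
  measurable A -> measurable B -> leb2 (A `*` B) = (mu A * mu B)%E.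
Proof. exact: product_measure1E. Qed.

(** The squares of an exhaustion of the line exhaust the plane. Sigma-finiteness matters because
    [leb2] is used below as a factor of further products, both on the centres and on the pairs of
    angles. *)
Lemma leb2_sigma_finite : sigma_finite setT leb2.
Proof.
have /sigma_finiteP[F [TF ndF Foo]] := sigma_finiteT mu.
exists (fun n => F n `*` F n).
  rewrite -setXTT TF predeqE => -[x y]; split.
    move=> [/= [n _ Fnx] [k _ Fky]]; exists (maxn n k) => //; split.
    - by move: x Fnx; exact/subsetPset/ndF/leq_maxl.
    - by move: y Fky; exact/subsetPset/ndF/leq_maxr.
  by move=> [n _ []/= ? ?]; split; exists n.
move=> k; have [? ?] := Foo k; split; first exact: measurableX.
by rewrite [ltLHS]leb2E// lte_mul_pinfty// ge0_fin_numE.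
Qed.

HB.instance Definition _ :=
  Measure_isSigmaFinite.Build _ _ _ leb2 leb2_sigma_finite.

Definition affine (a b x : R) : R := a * x + b.

Lemma measurable_affine (a b : R) :
  measurable_fun setT (affine a b : RT -> RT).
Proof. by apply: measurable_funD => //; apply: measurable_funM. Qed.

(** The pushforward of Lebesgue measure, scaled by [a], gives each interval ]x, y] its length, and
    this characterizes Lebesgue measure. *)
Lemma lebesgue_affine (a b : R) (A : set RT) : 0 < a -> measurable A ->
  mu (affine a b @^-1` A) = (a^-1%:E * mu A)%E.
Proof.
move=> a0 mA.
have an0 : a != 0 by rewrite gt_eqF.
pose phi := affine a b : RT -> RT.
have mphi : measurable_fun setT phi := measurable_affine a b.
pose a0' := NngNum (ltW a0).
pose m : {measure set RT -> \bar R} := mscale a0' (pushforward mu phi).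
suff -> : mu A = m mphi A.
  by rewrite /m /mscale/= muleA -EFinM mulVf// mul1e.
apply: lebesgue_measure_unique => // _ [[x y]] _ <-.
rewrite -[RHS]/(a%:E * mu (phi @^-1` [set` `]x, y]]))%E.
have -> : phi @^-1` [set` `]x, y]] = [set` `](x - b) / a, (y - b) / a]].
  apply/seteqP; split => z; rewrite /phi /affine /= !in_itv/= ltr_pdivrMr// ler_pdivlMr//;
  by rewrite ltrBlDr lerBrDr mulrC.
rewrite !lebesgue_measure_itv/= !lte_fin ltr_pM2r ?invr_gt0// ltrD2r.
case: ifP => _; last by rewrite mule0.
rewrite -!EFinB -EFinM; congr (_%:E); field.
exact: an0.
Qed.

Lemma lebesgue_shift (b : R) (A : set RT) : measurable A ->
  mu ((fun x : R => x + b) @^-1` A) = mu A.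
Proof.
move=> mA; rewrite -[RHS]mul1e -[in RHS]invr1 -(lebesgue_affine 1 b A ltr01 mA).
by congr (mu (preimage _ A)); apply/funext => x; rewrite /affine mul1r.
Qed.

Definition translate (t c : R * R) : R * R := (c.1 + t.1, c.2 + t.2).

Lemma measurable_translate (t : R * R) :
  measurable_fun setT (translate t : RT * RT -> RT * RT).
Proof.
by apply: measurable_fun_pair; apply: measurable_funD => //.
Qed.

(** The translated measure agrees with [leb2] on rectangles, by [lebesgue_shift] in each coordinate,
    and rectangles determine a product measure. *)
Lemma leb2_shift (t : R * R) (A : set (RT * RT)) : measurable A ->
  leb2 ((translate t) @^-1` A) = leb2 A.
Proof.
move=> mA.
pose phi := (translate t)
  : measurableTypeR R * RT -> RT * measurableTypeR R.
have mphi : measurable_fun setT phi := measurable_translate t.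
pose m : {measure set (RT * RT) -> \bar R} := pushforward leb2 phi.
symmetry; rewrite -[RHS]/(m mphi A).
suff H : forall B C : set RT, measurable B -> measurable C ->
    m mphi (B `*` C) = (mu B * mu C)%E.
  exact: (@product_measure_unique _ _ _ _ _ mu mu (m mphi) H A mA).
move=> B C mB mC; rewrite -[RHS]/(mu B * mu C)%E.
rewrite -[mu B](lebesgue_shift t.1 B)// -[mu C](lebesgue_shift t.2 C)//.
rewrite -leb2E//.
- by rewrite -[X in measurable X]setTI; apply: (measurable_funD _ _ measurableT).
- by rewrite -[X in measurable X]setTI; apply: (measurable_funD _ _ measurableT).
Qed.

Lemma integral_leb2_shift (t : R * R) (g : RT * RT -> \bar R) :
  measurable_fun setT g -> leb2.-integrable setT (fun c : RT * RT => g (translate t c)) ->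
  (\int[leb2]_c g (translate t c) = \int[leb2]_c g c)%E.
Proof.
move=> mg ig.
pose phi := (translate t) : RT * RT -> RT * RT.
have mphi : measurable_fun setT phi := measurable_translate t.
have := @integral_pushforward _ _ _ _ _ phi mphi leb2 setT g mg ig measurableT.
rewrite preimage_setT /comp => <-.
by apply: eq_measure_integral => A mA _; exact: (leb2_shift t A mA).
Qed.

Lemma ge0_integral_affine (a b : R) (D : set RT) (g : RT -> \bar R) :
  0 < a -> measurable D -> measurable_fun D g -> (forall x, (0 <= g x)%E) ->
  (\int[mu]_(x in affine a b @^-1` D) g (affine a b x) =
   a^-1%:E * \int[mu]_(x in D) g x)%E.
Proof.
move=> a0 mD mg g0.
pose phi := affine a b : RT -> RT.
have mphi : measurable_fun setT phi := measurable_affine a b.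
have := @ge0_integral_pushforward _ _ _ _ _ phi mphi mu D g mD mg (fun y _ => g0 y).
rewrite /comp => <-.
have ai0 : 0 <= a^-1 by rewrite invr_ge0 ltW.
have := @ge0_integral_mscale _ _ _ mu D mD (NngNum ai0) g mg (fun x _ => g0 x).
rewrite [X in _ = (X * _)%E -> _]/= => <-.
by apply: eq_measure_integral => A mA _; exact: (lebesgue_affine a b A a0 mA).
Qed.

(** The nonnegative case is applied to the positive and negative parts; integrability makes both
    integrals finite, so that [a^-1] distributes over their difference. *)
Lemma Rintegral_affine (a b : R) (D : set RT) (g : RT -> R) : 0 < a ->
  measurable D -> mu.-integrable D (EFin \o g) ->
  \int[mu]_(x in affine a b @^-1` D) g (affine a b x) =
  a^-1 * \int[mu]_(x in D) g x.
Proof.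
move=> a0 mD ig; rewrite /Rintegral.
have mg := measurable_int _ ig.
rewrite [in LHS]integralE.
rewrite [X in (X - _)%E](_ : _ =
    a^-1%:E * \int[mu]_(x in D) (EFin \o g)^\+ x)%E; last first.
  rewrite -(ge0_integral_affine a b D (EFin \o g)^\+%E a0 mD
    (measurable_funepos mg) (funepos_ge0 _)).
  by apply: eq_integral => x _; rewrite !funeposE.
rewrite [X in (_ - X)%E](_ : _ =
    a^-1%:E * \int[mu]_(x in D) (EFin \o g)^\- x)%E; last first.
  rewrite -(ge0_integral_affine a b D (EFin \o g)^\-%E a0 mD
    (measurable_funeneg mg) (funeneg_ge0 _)).
  by apply: eq_integral => x _; rewrite !funenegE.
have fp := integrable_pos_fin_num mD ig; have fn := integrable_neg_fin_num mD ig.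
rewrite [in RHS]integralE -muleBr ?fineM//; first by rewrite fin_numB fp.
by rewrite fin_num_adde_defr// fin_numN.
Qed.

End plane_measure.

(** * Fubini for the square of an integral *)

Section square_fubini.
Variable R : realType.
Local Notation mu := (@lebesgue_measure R).
Local Notation RT := (measurableTypeR R).
Local Notation leb2 := (leb2 R).

Lemma integrable_indic_bounded d (T : measurableType d)
    (m : {measure set T -> \bar R}) (g : T -> R) (A : set T) :
  measurable A -> (m A < +oo)%E -> measurable_fun setT g ->
  (forall x, `|g x| <= \1_A x) -> m.-integrable setT (EFin \o g).
Proof.
move=> mA finA mg gA.
apply: (@le_integrable _ _ _ _ _ measurableT (EFin \o g) (EFin \o (\1_A : T -> R))).
- exact/measurable_EFinP.
- by move=> x _ /=; rewrite lee_fin (le_trans (gA x))// ler_norm.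
- apply/integrableP; split; first exact/measurable_EFinP/measurable_indic.
  rewrite (eq_integral (fun x => (\1_A x)%:E)); last first.
    by move=> x _; rewrite gee0_abs// lee_fin.
  by rewrite integral_indic// setIT.
Qed.

Variables (d : measure_display) (T : measurableType d).
Variable m : {sigma_finite_measure set T -> \bar R}.
Variables (K : set T) (J : set RT).
Hypotheses (mK : measurable K) (mJ : measurable J).
Hypotheses (finK : (m K < +oo)%E) (finJ : (mu J < +oo)%E).

Section one_function.
Variable G : T * RT -> R.
Hypothesis mG : measurable_fun setT G.
Hypothesis GKJ : forall c s, `|G (c, s)| <= \1_K c * \1_J s.

Let mGc c : measurable_fun setT (fun s => G (c, s)).
Proof. exact: (measurable_fun_pair2 _ mG). Qed.

Let G1 c s : `|G (c, s)| <= \1_J s.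
Proof.
apply: (le_trans (GKJ c s)); rewrite ler_piMl ?indicE//.
by case: (_ \in _).
Qed.

Let integrable_slice c : mu.-integrable setT (fun s => (G (c, s))%:E).
Proof. exact: (integrable_indic_bounded _ _ _ _ J). Qed.

Let finJJ : (leb2 (J `*` J) < +oo)%E.
Proof. by rewrite leb2E// lte_mul_pinfty// ge0_fin_numE. Qed.

Let mGG c : measurable_fun setT (fun z : RT * RT => G (c, z.1) * G (c, z.2)).
Proof.
apply: measurable_funM.
  exact: (measurableT_comp (mGc c) measurable_fst).
exact: (measurableT_comp (mGc c) measurable_snd).
Qed.

Let indicX (s t : RT) : \1_(J `*` J) (s, t) = \1_J s * \1_J t :> R.
Proof. by rewrite !indicE in_setX /=; do 2 case: (_ \in _); rewrite ?mulr0 ?mulr1. Qed.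

(** For fixed [c] the product is dominated by the indicator of the square of [J], so Fubini
    evaluates the double integral one variable at a time. *)
Lemma sqr_integral_slice c :
  (\int[leb2]_z (G (c, z.1) * G (c, z.2))%:E)%E =
  ((\int[mu]_s G (c, s)) ^+ 2)%:E.
Proof.
have iGG : leb2.-integrable setT
    (EFin \o (fun z : RT * RT => G (c, z.1) * G (c, z.2))).
  apply: (integrable_indic_bounded _ _ _ _ (J `*` J)) => //.
    exact: measurableX.
  by move=> [s t]; rewrite normrM indicX ler_pM.
have := @integral12_prod_meas1 _ _ _ _ R mu mu _ iGG.
rewrite -[(mu \x mu)%E]/leb2 => <-.
rewrite /fubini_F /=.
under eq_integral => s _.
  under eq_integral do rewrite EFinM.
  rewrite integralZl// -[X in (_ * X)%E]fineK ?integrable_fin_num//.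
  rewrite muleC.
  over.
by rewrite integralZl// -[X in (_ * X)%E]fineK ?integrable_fin_num.
Qed.

Lemma measurable_integral_slice :
  measurable_fun setT (fun c => \int[mu]_s G (c, s)).
Proof.
have iG : (m \x mu)%E.-integrable setT (EFin \o G).
  apply: (integrable_indic_bounded _ _ _ _ (K `*` J)) => //.
  - exact: measurableX.
  - by rewrite [ltLHS]product_measure1E// lte_mul_pinfty// ge0_fin_numE.
  - move=> [c s]; rewrite (le_trans (GKJ c s))// !indicE !in_setX/=.
    by do 2 case: (_ \in _); rewrite ?(mulr0,mul0r,mulr1).
rewrite (_ : (fun c => _) = fine \o fubini_F mu (EFin \o G))//.
apply: measurableT_comp; first exact: fine_measurable.
exact: (measurable_fubini_F iG).
Qed.

Let mH : measurable_fun setT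
  (fun x : T * (RT * RT) => G (x.1, x.2.1) * G (x.1, x.2.2)).
Proof.
by apply: measurable_funM; apply: (measurableT_comp mG);
  apply: measurable_fun_pair => //; exact: measurableT_comp.
Qed.

Let iH : (m \x leb2)%E.-integrable setT
  (EFin \o (fun x : T * (RT * RT) => G (x.1, x.2.1) * G (x.1, x.2.2))).
Proof.
apply: (integrable_indic_bounded _ _ _ _ (K `*` (J `*` J))) => //.
- by apply: measurableX => //; exact: measurableX.
- rewrite [ltLHS]product_measure1E//; last exact: measurableX.
  by rewrite lte_mul_pinfty// ge0_fin_numE.
- move=> [c [s t]]; rewrite normrM /=.
  rewrite (le_trans (ler_pM _ _ (GKJ c s) (GKJ c t)))// !indicE !in_setX/=.
  by do 3 case: (_ \in _); rewrite ?(mulr0,mul0r,mulr1).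
Qed.

Definition autocorrelation (z : RT * RT) : \bar R :=
  (\int[m]_c (G (c, z.1) * G (c, z.2))%:E)%E.

(** The product of the two values of [G] is integrable in c, s, t jointly, and integrating its
    absolute value over [c] first gives a dominating function. This lets the sum over [I] pass under
    the integral in [sum_sqr_integral_ge]. *)
Lemma integrable_autocorrelation : leb2.-integrable setT autocorrelation.
Proof.
have mEH := measurable_int _ iH.
apply/integrableP; split; first exact: (measurable_fubini_G iH).
have lty := (@integrable21ltyP _ _ _ _ _ m leb2 _ mEH).1 iH.
apply: (le_lt_trans _ lty).
apply: ge0_le_integral => //.
- by apply: measurableT_comp => //; exact: (measurable_fubini_G iH).
- have mabs := measurable_int _ (integrable_abse iH).
  exact: (measurable_fun_fubini_tonelli_G (m1 := m) _ mabs (fun=> abse_ge0 _)).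
- move=> z _; apply: le_abse_integral => //.
  exact: (measurable_fun_pair1 _ mEH).
Qed.

Lemma integral_autocorrelation :
  (\int[m]_c ((\int[mu]_s G (c, s)) ^+ 2)%:E =
   \int[leb2]_z autocorrelation z)%E.
Proof.
under eq_integral do rewrite -sqr_integral_slice.
exact: (Fubini iH).
Qed.

End one_function.

(** A pointwise bound in the two angles is integrated over them. As [\1_W] vanishes off [W], the
    last hypothesis asks there just for a nonnegative sum, which is where the positivity of the
    correlations enters. *)
Lemma sum_sqr_integral_ge (I : finType) (G : I -> T * RT -> R)
    (W : set (RT * RT)) (q : R) :
  (forall i, measurable_fun setT (G i)) ->
  (forall i c s, `|G i (c, s)| <= \1_K c * \1_J s) ->
  measurable W -> 0 <= q ->
  (forall z, (q * \1_W z)%:E <=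
     \sum_(i : I) \int[m]_c (G i (c, z.1) * G i (c, z.2))%:E)%E ->
  (q%:E * leb2 W <=
   \sum_(i : I) \int[m]_c ((\int[mu]_s G i (c, s)) ^+ 2)%:E)%E.
Proof.
move=> mG GKJ mW q0 qW.
under eq_bigr do rewrite integral_autocorrelation//.
have iA i := integrable_autocorrelation (G i) (mG i) (GKJ i).
rewrite -integral_sum//.
rewrite -(setIT W) -integral_indic// -ge0_integralZl_EFin//; last first.
  by apply/measurable_EFinP; exact: measurable_indic.
have q1 z : (0 <= q%:E * (\1_W z)%:E)%E by rewrite mule_ge0 ?lee_fin.
apply: ge0_le_integral => //.
- by apply/measurable_EFinP; apply: measurable_funM => //; exact: measurable_indic.
- by apply: emeasurable_sum => i; exact: measurable_int (iA i).
- by move=> z _; rewrite -EFinM; exact: qW.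
Qed.

End square_fubini.

(** * Cellwise constant functions and the correlation identity *)

Section plane_functions.
Variable R : realType.
Local Notation mu := (@lebesgue_measure R).
Local Notation RT := (measurableTypeR R).
Local Notation leb2 := (leb2 R).

Lemma measurable_unit_cell (m n : int) :
  measurable (unit_cell m n : set (RT * RT)).
Proof.
have -> : unit_cell m n =
    (`[m%:~R, m%:~R + 1[ : set RT) `*` (`[n%:~R, n%:~R + 1[ : set RT) :> set (R * R).
  by apply/seteqP; split => p; rewrite /unit_cell/= !in_itv/= => /andP.
exact: measurableX.
Qed.

Lemma unit_cell_floor (p : R * R) :
  unit_cell (Num.floor p.1) (Num.floor p.2) p.
Proof.
by rewrite /unit_cell/=; have := floor_itv p.1; have := floor_itv p.2;
  rewrite !intrD => -> ->.
Qed.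

(** Each preimage is a countable union of cells, those at whose lower left corner [f] takes a value
    in the given set. *)
Lemma cellwise_constant_measurable (f : R * R -> R) :
  cellwise_constant f -> measurable_fun setT (f : RT * RT -> R).
Proof.
move=> cf _ Y mY; rewrite setTI.
have -> : f @^-1` Y = \bigcup_(k : int * int)
    [set p | Y (f (k.1%:~R, k.2%:~R)) /\ unit_cell k.1 k.2 p].
  apply/seteqP; split => [p Yp|p [[m n] _ /= [Ymn mnp]]].
    exists (Num.floor p.1, Num.floor p.2) => //=.
    split; last exact: unit_cell_floor.
    rewrite (cf (Num.floor p.1) (Num.floor p.2) _ p) //; last exact: unit_cell_floor.
    by rewrite /unit_cell/= !lexx !ltrDl !ltr01.
  rewrite /preimage/= (cf m n p (m%:~R, n%:~R)) //.
  by rewrite /unit_cell/= !lexx !ltrDl !ltr01.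
apply: countable_bigcupT_measurable; first exact: countableP.
move=> k; have [Yk|nYk] := pselect (Y (f (k.1%:~R, k.2%:~R))).
  rewrite (_ : [set p | _ /\ _] = unit_cell k.1 k.2).
    exact: measurable_unit_cell.
  by apply/seteqP; split => p; [case|split].
rewrite (_ : [set p | _ /\ _] = set0); first exact: measurable0.
by apply/seteqP; split => p // [].
Qed.

(* Translating c by [P' u - P v] in the term of index (u, v) makes the two factors
   depend on u and on v only. *)
Lemma sum_correlation (U : finType) (F : RT * RT -> R) (B : set (RT * RT))
    (P P' : U -> R * R) :
  measurable_fun setT F -> measurable B -> (leb2 B < +oo)%E ->
  (forall c, `|F c| <= \1_B c) ->
  (\sum_(i : U * U) \int[leb2]_c (F (translate R (P i.2 - P i.1) c) *
      F (translate R (P' i.2 - P' i.1) c))%:E =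
   \int[leb2]_c ((\sum_(u : U) F (translate R (P' u - P u) c)) ^+ 2)%:E)%E.
Proof.
move=> mF mB finB FB.
pose h a b (c : RT * RT) := F (translate R a c) * F (translate R b c).
have mFt t : measurable_fun setT (fun c : RT * RT => F (translate R t c)).
  exact: (measurableT_comp mF (measurable_translate R t)).
have mh a b : measurable_fun setT (h a b) by exact: measurable_funM.
have ih a b : leb2.-integrable setT (EFin \o h a b).
  apply: (integrable_indic_bounded _ _ _ leb2 _ (translate R a @^-1` B)) => //.
  - rewrite -[X in measurable X]setTI.
    exact: (measurable_translate R a measurableT B mB).
  - have sh : leb2 (translate R a @^-1` B) = leb2 B by exact: leb2_shift.
    by rewrite [ltLHS]sh.
  - move=> c; rewrite /h normrM.
    have F1 p : `|F p| <= 1.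
      by rewrite (le_trans (FB p))// indicE; case: (_ \in _).
    by rewrite (le_trans (ler_piMr _ (F1 _)))//.
have hE t a b c : h a b (translate R t c) = h (a + t) (b + t) c.
  by rewrite /h /translate/= ![_ + t.1 + _]addrAC ![_ + t.2 + _]addrAC !addrA.
transitivity (\sum_(i : U * U) \int[leb2]_c
    (h (P' i.1 - P i.1)%R (P' i.2 - P i.2)%R c)%:E)%E.
  apply: eq_bigr => -[u v] _ /=.
  rewrite -(integral_leb2_shift R (P v - P' u)
    (EFin \o h (P' u - P u) (P' v - P v))).
  - apply: eq_integral => c _ /=; rewrite hE /h.
    congr ((F (translate R _ _) * F (translate R _ _))%:E).
      by rewrite [RHS]addrC addrA subrK.
    by rewrite addrA subrK.
  - exact/measurable_EFinP.
  - apply: eq_integrable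
      (ih (P' u - P u + (P v - P' u)) (P' v - P v + (P v - P' u))) => //.
    by move=> c _ /=; rewrite hE.
rewrite -integral_sum//; last by move=> i; exact: ih.
apply: eq_integral => c _.
(* With u and v separated, the sum over pairs factors into a square. *)
rewrite sumEFin; congr (_%:E).
by rewrite expr2 big_distrlr/= pair_big/=.
Qed.

End plane_functions.

(** * Rotations, polar angles and the topology of circles *)

Section circles.
Variable R : realType.
Local Notation mu := (@lebesgue_measure R).
Local Notation RT := (measurableTypeR R).
Implicit Types (s t a b r : R) (c x : R * R).

Lemma lipschitz_of_derive (g dg : R -> R) :
  (forall y : R, is_derive y 1 g (dg y)) -> (forall y, `|dg y| <= 1) ->
  forall a b, `|g a - g b| <= `|a - b|.
Proof.
move=> gd dg1.
suff H a b : a <= b -> `|g b - g a| <= `|b - a|.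
  move=> a b; have [ab|/ltW ba] := leP a b; last exact: H.
  by rewrite distrC (distrC a); exact: H.
move=> ab.
have cg : {within `[a, b], continuous g}.
  apply: continuous_subspaceT => y; apply: differentiable_continuous.
  by apply/derivable1_diffP; apply: ex_derive.
have [y _ ->] := MVT_segment ab (fun y _ => gd y) cg.
by rewrite normrM ler_piMl.
Qed.

Lemma lipschitz_cos a b : `|cos a - cos b| <= `|a - b|.
Proof.
apply: (lipschitz_of_derive _ (fun y => - sin y)) => y.
by rewrite normrN ler_norml sin_geN1 sin_le1.
Qed.

Lemma lipschitz_sin a b : `|sin a - sin b| <= `|a - b|.
Proof.
apply: (lipschitz_of_derive _ cos) => y.
by rewrite ler_norml cos_geN1 cos_le1.
Qed.

Definition rotation s x : R * R :=
  (x.1 * cos s - x.2 * sin s, x.1 * sin s + x.2 * cos s).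

Lemma rotationB s x y : rotation s (x - y) = rotation s x - rotation s y.
Proof. by rewrite /rotation/=; congr (_, _); rewrite /=; ring. Qed.

(** The l1 norm bounds both coordinates of every rotated copy of [x], which suits the axis-parallel
    boxes used below. *)
Definition norm1 x : R := `|x.1| + `|x.2|.

Lemma norm_cos s : `|cos s| <= 1.
Proof. by rewrite ler_norml cos_geN1 cos_le1. Qed.

Lemma norm_sin s : `|sin s| <= 1.
Proof. by rewrite ler_norml sin_geN1 sin_le1. Qed.

Lemma rotation_bound s x :
  `|(rotation s x).1| <= norm1 x /\ `|(rotation s x).2| <= norm1 x.
Proof.
rewrite /norm1; split => /=.
  by rewrite (le_trans (ler_normB _ _))// !normrM lerD// ler_piMr// ?norm_cos ?norm_sin.
by rewrite (le_trans (ler_normD _ _))// !normrM lerD// ler_piMr// ?norm_cos ?norm_sin.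
Qed.

(** Sine and cosine are 1-Lipschitz. This controls how far a grid point moves between two nearby
    angles. *)
Lemma rotationB_bound s t x :
  `|(rotation s x - rotation t x).1| <= `|s - t| * norm1 x /\
  `|(rotation s x - rotation t x).2| <= `|s - t| * norm1 x.
Proof.
rewrite /norm1 mulrDr; split => /=.
  rewrite (_ : _ - _ = (cos s - cos t) * x.1 - (sin s - sin t) * x.2); last by ring.
  rewrite (le_trans (ler_normB _ _))// !normrM lerD// ler_wpM2r//.
    exact: lipschitz_cos.
  exact: lipschitz_sin.
rewrite (_ : _ - _ = (sin s - sin t) * x.1 + (cos s - cos t) * x.2); last by ring.
rewrite (le_trans (ler_normD _ _))// !normrM lerD// ler_wpM2r//.
  exact: lipschitz_sin.
exact: lipschitz_cos.
Qed.

(** [acos a] has the right cosine and its sine is the absolute value of [b]; for negative [b] it is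
    reflected to [2 * pi - acos a]. *)
Lemma unit_angle a b : a ^+ 2 + b ^+ 2 = 1 ->
  exists2 t, 0 <= t < 2 * pi & a = cos t /\ b = sin t.
Proof.
move=> ab1.
have a1 : -1 <= a <= 1.
  by rewrite -ler_norml -(@expr_le1 _ 2)// real_normK ?num_real// -ab1 lerDl sqr_ge0.
have [/andP[t0 tpi] ct] := acos_def a1.
have st : sin (acos a) = `|b|.
  rewrite sin_acos// -sqrtr_sqr; congr Num.sqrt; lra.
have pi0 := pi_gt0 R.
have [b0|b0] := leP 0 b.
  exists (acos a); first by lra.
  by rewrite ct st ger0_norm.
(* Otherwise [2 * pi - acos a] would not be below [2 * pi]. *)
have tn0 : acos a != 0.
  by apply/negP => /eqP t00; move: st; rewrite t00 sin0;
    move=> /esym/eqP; rewrite normr_eq0 lt_eqF.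
exists (2 * pi - acos a).
  by move: t0; rewrite le_eqVlt eq_sym (negbTE tn0)/= => t0; lra.
rewrite cosB sinB (_ : 2 * pi = pi *+ 2); last by rewrite mulrC mulr_natr.
rewrite cos2pi sin2pi ct st ltr0_norm//; split; ring.
Qed.

Lemma polar_angle x : x != 0 ->
  let r := Num.sqrt (x.1 ^+ 2 + x.2 ^+ 2) in
  0 < r /\ exists2 t, 0 <= t < 2 * pi & x = (r * cos t, r * sin t).
Proof.
move=> x0 r.
have r20 : 0 < x.1 ^+ 2 + x.2 ^+ 2.
  rewrite lt_neqAle addr_ge0 ?sqr_ge0// andbT eq_sym paddr_eq0 ?sqr_ge0//.
  by rewrite !sqrf_eq0 -xpair_eqE -surjective_pairing.
have r0 : 0 < r by rewrite sqrtr_gt0.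
have rn0 : r != 0 by rewrite gt_eqF.
split => //.
have : (x.1 / r) ^+ 2 + (x.2 / r) ^+ 2 = 1.
  rewrite !exprMn -mulrDl exprVn sqr_sqrtr ?ltW// divff// gt_eqF//.
move=> /unit_angle[t t2pi [ct st]]; exists t => //.
by rewrite -ct -st !(mulrC r) !divfK// -surjective_pairing.
Qed.

Lemma circle_range c r : 0 < r -> circle c r = range (circle_param c r).
Proof.
move=> r0; have rn0 : r != 0 by rewrite gt_eqF.
apply/seteqP; split => [p|p [s _ <-]]; rewrite /circle/=; last first.
  rewrite ![_ + _ * _ - _]addrAC !subrr !add0r !exprMn -mulrDr.
  by rewrite addrC sin2cos2 ?subrK ?mulr1.
move=> pr; have : ((p.1 - c.1) / r) ^+ 2 + ((p.2 - c.2) / r) ^+ 2 = 1.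
  by rewrite !exprMn -mulrDl pr -exprMn divff// expr1n.
move=> /unit_angle[t _ [ct st]]; exists (r * t) => //.
rewrite /circle_param (mulrC r t) mulfK// -ct -st !(mulrC r) !divfK//.
by rewrite !(addrC c.1) !(addrC c.2) !subrK -surjective_pairing.
Qed.

Lemma continuous_circle_param c r : continuous (circle_param c r).
Proof.
move=> s.
have cvg_div : t / r @[t --> s] --> s / r by apply: cvgM; [exact: cvg_id|exact: cvg_cst].
have cvg1 : c.1 + r * cos (t / r) @[t --> s] --> c.1 + r * cos (s / r).
  apply: cvgD; first exact: cvg_cst.
  apply: cvgM; first exact: cvg_cst.
  exact: (continuous_cvg _ (@continuous_cos R _) cvg_div).
have cvg2 : c.2 + r * sin (t / r) @[t --> s] --> c.2 + r * sin (s / r).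
  apply: cvgD; first exact: cvg_cst.
  apply: cvgM; first exact: cvg_cst.
  exact: (continuous_cvg _ (@continuous_sin R _) cvg_div).
exact: (cvg_pair cvg1 cvg2).
Qed.

(** A circle is connected as the continuous image of the line. Full circles are the arcs that the
    argument produces. *)
Lemma circular_arc_circle c r : 0 < r -> circular_arc c r (circle c r).
Proof.
move=> r0; split => //; first by rewrite circle_range//; exists (circle_param c r 0), 0.
rewrite circle_range//; apply: connected_continuous_connected.
  by apply/connected_intervalP.
exact: continuous_subspaceT (continuous_circle_param c r).
Qed.

End circles.

(** * Integrals over circles as integrals over rotation angles *)

Section arcs.
Variable R : realType.
Local Notation mu := (@lebesgue_measure R).
Local Notation RT := (measurableTypeR R).
Local Notation leb2 := (leb2 R).
Implicit Types (s t a b r : R) (c x : R * R).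

Lemma integrable_bounded1 (D : set RT) (g : RT -> R) :
  measurable D -> (mu D < +oo)%E -> measurable_fun setT g ->
  (forall t, `|g t| <= 1) -> mu.-integrable D (EFin \o g).
Proof.
move=> mD finD mg g1; apply: measurable_bounded_integrable => //.
  exact: measurable_funTS.
by exists 1; split; rewrite ?num_real// => M M1 t _; exact: (le_trans (g1 t) (ltW M1)).
Qed.

Lemma lebesgue_itvco_lty a b : (mu `[a, b[%classic < +oo)%E.
Proof. by rewrite lebesgue_measure_itv/=; case: ifP => _; rewrite -?EFinB ltry. Qed.

Lemma Rintegral_shift a b t (g : RT -> R) :
  measurable_fun setT g -> (forall s, `|g s| <= 1) ->
  \int[mu]_(s in `[a, b[) g (s + t) = \int[mu]_(s in `[a + t, b + t[) g s.
Proof.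
move=> mg g1.
have mab : measurable (`[a + t, b + t[%classic : set RT) by [].
have := Rintegral_affine R 1 t _ g ltr01 mab
  (integrable_bounded1 _ _ mab (lebesgue_itvco_lty _ _) mg g1).
rewrite invr1 mul1r => <-.
rewrite (_ : affine R 1 t @^-1` _ = `[a, b[%classic); last first.
  by apply/seteqP; split => s; rewrite /affine/= !in_itv/= mul1r lerD2r ltrD2r.
by apply: eq_Rintegral => s _; rewrite /affine mul1r.
Qed.

Lemma Rintegral_itv_split a b t (g : RT -> R) : a <= b -> b <= t ->
  measurable_fun setT g -> (forall s, `|g s| <= 1) ->
  \int[mu]_(s in `[a, t[) g s =
  \int[mu]_(s in `[a, b[) g s + \int[mu]_(s in `[b, t[) g s.
Proof.
move=> ab bt mg g1.
have U : `[a, t[%classic = (`[a, b[%classic `|` `[b, t[%classic) :> set RT.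
  apply/seteqP; split => s; rewrite /= !in_itv/=.
    by move=> /andP[-> ->]; have [sb|bs] := ltP s b; [left|right].
  by move=> [/andP[-> sb]|/andP[bs ->]]; rewrite ?(lt_le_trans sb)// (le_trans ab).
rewrite U Rintegral_setU//.
- rewrite -U; apply: integrable_bounded1 => //; exact: lebesgue_itvco_lty.
- apply/disj_setPS => s; rewrite /= !in_itv/= => -[/andP[_ sb] /andP[bs _]].
  by move: (lt_le_trans sb bs); rewrite ltxx.
Qed.

(** The shifted window [t, p + t[ exceeds p by a piece of length t, which periodicity moves back to
    [0, t[. *)
Lemma Rintegral_periodic t (p : R) (g : RT -> R) : 0 <= t < p ->
  measurable_fun setT g -> (forall s, `|g s| <= 1) ->
  (forall s, g (s + p) = g s) ->
  \int[mu]_(s in `[0, p[) g (s + t) = \int[mu]_(s in `[0, p[) g s.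
Proof.
move=> /andP[t0 tp] mg g1 gp.
rewrite Rintegral_shift// add0r (Rintegral_itv_split t p (p + t))//; last 2 first.
- exact: ltW.
- by rewrite lerDl.
rewrite [X in _ + X](_ : _ = \int[mu]_(s in `[0, t[) g s); last first.
  rewrite -[p in `[p, _[]add0r (addrC p t) -Rintegral_shift//.
  by apply: eq_Rintegral => s _; rewrite gp.
by rewrite addrC -Rintegral_itv_split// ltW.
Qed.

Definition polar r t : R * R := (r * cos t, r * sin t).

Lemma rotation_polar r t s : rotation R s (polar r t) = polar r (s + t).
Proof. by rewrite /rotation /polar/= cosD sinD; congr (_, _); ring. Qed.

Lemma measurable_cos : measurable_fun setT (cos : RT -> R).
Proof. apply: continuous_measurable_fun; exact: continuous_cos. Qed.

Lemma measurable_sin : measurable_fun setT (sin : RT -> R).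
Proof. apply: continuous_measurable_fun; exact: continuous_sin. Qed.

Section sign_function.
Variable f : R * R -> R.
Hypothesis mf : measurable_fun setT (f : RT * RT -> R).
Hypothesis f1 : forall p, `|f p| <= 1.

Lemma measurable_circle_fun r c :
  measurable_fun setT (fun t : RT => f (translate R (polar r t) c)).
Proof.
apply: (measurableT_comp mf); apply: measurable_fun_pair.
  by apply: measurable_funD => //; apply: measurable_funM => //; exact: measurable_cos.
by apply: measurable_funD => //; apply: measurable_funM => //; exact: measurable_sin.
Qed.

(** Substituting s = r t in the arc-length integral produces the factor [r]. *)
Lemma arc_integral_circle r c : 0 < r ->
  arc_integral c r (circle c r) f =
  r * \int[mu]_(t in `[0, 2 * pi[) f (translate R (polar r t) c).
Proof.
move=> r0.
rewrite /arc_integral circle_range//.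
rewrite (_ : circle_param c r @^-1` _ = setT); last first.
  by apply/seteqP; split => // t _; exists t.
rewrite setIT.
pose g (t : RT) := f (translate R (polar r t) c).
have m2pi : measurable (`[0, 2 * pi[%classic : set RT) by [].
have ri : 0 < r^-1 by rewrite invr_gt0.
have := Rintegral_affine R r^-1 0 _ g ri m2pi
  (integrable_bounded1 _ _ m2pi (lebesgue_itvco_lty _ _) (measurable_circle_fun r c)
   (fun t => f1 _)).
rewrite invrK => <-.
rewrite (_ : affine R r^-1 0 @^-1` _ = `[0, 2 * pi * r[%classic); last first.
  apply/seteqP; split => t; rewrite /affine/= !in_itv/= addr0 (mulrC r^-1);
  by rewrite ltr_pdivrMr// ler_pdivlMr// mul0r.
apply: eq_Rintegral => t _; rewrite /g /affine addr0 /circle_param /translate/=.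
by rewrite (mulrC r^-1) (addrC c.1) (addrC c.2).
Qed.

(** In polar form a rotation by [s] adds [s] to the angle of [x], so the integrand runs through the
    circle from another starting angle; periodicity removes this offset. *)
Lemma rotation_integral_arc x c : x != 0 ->
  let r := Num.sqrt (x.1 ^+ 2 + x.2 ^+ 2) in
  0 < r /\ \int[mu]_(s in `[0, 2 * pi[) f (translate R (rotation R s x) c) =
           r^-1 * arc_integral c r (circle c r) f.
Proof.
move=> /polar_angle /= [r0 [t t2pi xE]]; split => //.
set r := Num.sqrt _ in r0 xE *.
rewrite arc_integral_circle// mulKf ?gt_eqF//.
pose g (s : RT) := f (translate R (polar r s) c).
rewrite -(Rintegral_periodic t (2 * pi) g) //.
- by apply: eq_Rintegral => s _; rewrite /g -rotation_polar /polar -xE.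
- exact: measurable_circle_fun.
- by move=> s; exact: f1.
- move=> s; rewrite /g /polar (_ : 2 * pi = pi *+ 2); last by rewrite mulrC mulr_natr.
  by rewrite cosD2pi sinD2pi.
Qed.

End sign_function.
End arcs.

(** * Sums of inverse distances between grid points *)

Section counting.
Variable R : realType.
Local Open Scope nat_scope.

(* One of the two truncated differences is 0. *)
Definition gap (i j : nat) : nat := (i - j) + (j - i).

Lemma natr_gap (i j : nat) : `|i%:R - j%:R|%R = (gap i j)%:R :> R.
Proof.
rewrite /gap; have [ij|/ltnW ji] := leqP i j.
  move: (ij); rewrite -subn_eq0 => /eqP ->.
  by rewrite add0n natrB// ler0_norm ?opprB// subr_le0 ler_nat.
move: (ji); rewrite -subn_eq0 => /eqP ->.
by rewrite addn0 natrB// ger0_norm// subr_ge0 ler_nat.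
Qed.

Lemma gap_eq0 (i j : nat) : (gap i j == 0) = (i == j).
Proof. by rewrite /gap addn_eq0 !subn_eq0 eqn_leq. Qed.

(** Every distance from [i] occurs at most twice, once on each side. *)
Lemma sum_gap_le (n i : nat) (g : nat -> R) : (forall a, (0 <= g a)%R) -> i < n ->
  (\sum_(0 <= j < n) g (gap i j) <= 2 * \sum_(0 <= a < n) g a)%R.
Proof.
move=> g0 iN.
have sumS k : k <= n -> (\sum_(0 <= a < k) g a <= \sum_(0 <= a < n) g a)%R.
  by move=> kn; rewrite (big_cat_nat _ kn)//= lerDl sumr_ge0.
rewrite (big_cat_nat _ (ltnW iN))//= mulr_natl mulr2n lerD//.
  rewrite big_nat_rev/= (le_trans _ (sumS i.+1 iN))//.
  (* To the left of i the distances are 1, ..., i; the nonnegative term at distance 0 completes the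
     sum. *)
  rewrite big_nat_recl// -[leLHS]add0r lerD//.
  rewrite big_nat [leRHS]big_nat ler_sum// => a /= ai.
  by rewrite (_ : gap _ _ = a.+1)// /gap; lia.
rewrite -[X in (\sum_(X <= _ < _) _)%R]add0n big_addn.
rewrite (le_trans _ (sumS (n - i) (leq_subr _ _)))//.
by rewrite ler_sum// => a _; rewrite (_ : gap _ _ = a)// /gap; lia.
Qed.

(* The term at a = b = 0 is 0^-1 = 0. *)
Lemma sum_inv_max_le (n : nat) :
  (\sum_(0 <= a < n) \sum_(0 <= b < n) (maxn a b)%:R^-1 <= 3 * n%:R :> R)%R.
Proof.
elim: n => [|n IHn]; first by rewrite big_nil mulr0.
rewrite big_nat_recr//=.
under eq_bigr do rewrite big_nat_recr//=.
rewrite big_split/= -addrA.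
(* The new row and column hold 2n + 1 terms 1/n, in all 2 + 1/n <= 3 for positive n; for n = 0 they
   contribute 0. *)
have rowE : (\sum_(0 <= a < n) (maxn a n)%:R^-1 = n%:R * n%:R^-1 :> R)%R.
  under eq_big_nat => a /andP[_ an] do rewrite (maxn_idPr (ltnW an)).
  by rewrite big_const_nat subn0 iter_addr addr0 mulr_natl.
have colE : (\sum_(0 <= b < n.+1) (maxn n b)%:R^-1 = n.+1%:R * n%:R^-1 :> R)%R.
  under eq_big_nat => a /andP[_ an] do rewrite (maxn_idPl (an : a <= n)).
  by rewrite big_const_nat subn0 iter_addr addr0 mulr_natl.
rewrite rowE colE [X in (_ <= 3 * X)%R]mulrSr mulrDr mulr1 lerD//.
case: n {IHn rowE colE} => [|n]; first by rewrite invr0 !mulr0 addr0.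
rewrite -[X in (_ + X * _)%R]natr1 mulrDl divff ?pnatr_eq0// mul1r.
have : (n.+1%:R^-1 <= 1 :> R)%R by rewrite invf_le1 ?ltr0n// ler1n.
by move: (n.+1%:R^-1)%R => y; lra.
Qed.

(** For each of the n^2 points u, [sum_gap_le] in both coordinates costs a factor 4, and
    [sum_inv_max_le] gives 3n. *)
Lemma sum_pairs_inv_gap_le (n : nat) :
  (\sum_(i : ('I_n * 'I_n) * ('I_n * 'I_n))
     (maxn (gap i.1.1 i.2.1) (gap i.1.2 i.2.2))%:R^-1 <= 12 * n%:R ^+ 3 :> R)%R.
Proof.
rewrite -(pair_bigA _ (fun (u v : 'I_n * 'I_n) =>
  (maxn (gap u.1 v.1) (gap u.2 v.2))%:R^-1 : R)).
have inner (u : 'I_n * 'I_n) : (\sum_(v : 'I_n * 'I_n)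
     (maxn (gap u.1 v.1) (gap u.2 v.2))%:R^-1 <= 12 * n%:R :> R)%R.
  rewrite -(pair_bigA _ (fun (v1 v2 : 'I_n) =>
    (maxn (gap u.1 v1) (gap u.2 v2))%:R^-1 : R))/=.
  have g0 (a b : nat) : (0 <= (maxn a b)%:R^-1 :> R)%R by rewrite invr_ge0.
  apply: (@le_trans _ _
    (\sum_(v1 < n) 2 * \sum_(0 <= b < n) (maxn (gap u.1 v1) b)%:R^-1)%R).
    apply: ler_sum => v1 _.
    have := sum_gap_le n u.2 (fun b => (maxn (gap u.1 v1) b)%:R^-1)%R (g0 _) (ltn_ord _).
    by rewrite [X in (X <= _)%R -> _]big_mkord.
  rewrite -mulr_sumr.
  have := sum_gap_le n u.1 (fun a => \sum_(0 <= b < n) (maxn a b)%:R^-1)%R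
    (fun a => sumr_ge0 _ (fun b _ => g0 a b)) (ltn_ord _).
  rewrite [X in (X <= _)%R -> _]big_mkord.
  have := sum_inv_max_le n; lra.
apply: le_trans (ler_sum _ (fun u _ => inner u)) _.
rewrite sumr_const card_prod card_ord -[X in (X <= _)%R]mulr_natr natrM.
by rewrite -!mulrA -expr2 -exprS.
Qed.

End counting.

(** * Cutting off to a square, and the upper bound *)

Section truncation.
Variable R : realType.
Local Notation mu := (@lebesgue_measure R).
Local Notation RT := (measurableTypeR R).
Local Notation leb2 := (leb2 R).
Implicit Types (s t a b r : R) (c x : R * R).

Definition box a b : set (RT * RT) :=
  (`[a, b[%classic : set RT) `*` (`[a, b[%classic : set RT).

Lemma boxP a b c : box a b c <-> (a <= c.1 < b) /\ (a <= c.2 < b).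
Proof. by rewrite /box /= !in_itv. Qed.

Lemma measurable_box a b : measurable (box a b).
Proof. exact: measurableX. Qed.

Lemma leb2_box a b : a <= b -> leb2 (box a b) = ((b - a) ^+ 2)%:E.
Proof.
move=> ab; rewrite leb2E// lebesgue_measure_itv/= lte_fin.
move: ab; rewrite le_eqVlt => /predU1P[->|->].
  by rewrite ltxx mule0 subrr expr0n.
by rewrite -EFinB -EFinM expr2.
Qed.

Lemma leb2_box_lty a b : (leb2 (box a b) < +oo)%E.
Proof.
by rewrite leb2E// lte_mul_pinfty ?lebesgue_itvco_lty// ge0_fin_numE// lebesgue_itvco_lty.
Qed.

Lemma indic_in (T : Type) (A : set T) (y : T) : A y -> \1_A y = 1 :> R.
Proof. by move=> Ay; rewrite indicE mem_set. Qed.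

Lemma indic_notin (T : Type) (A : set T) (y : T) : ~ A y -> \1_A y = 0 :> R.
Proof. by move=> Ay; rewrite indicE memNset. Qed.

Variable f : R * R -> R.
Hypothesis mf : measurable_fun setT (f : RT * RT -> R).
Hypothesis f1 : forall p, `|f p| = 1.
Variable N : R.

Definition truncated (c : RT * RT) : R := f c * \1_(box 0 N) c.

Lemma measurable_truncated : measurable_fun setT truncated.
Proof.
by apply: measurable_funM => //; apply: measurable_indic; exact: measurable_box.
Qed.

Lemma truncated_bound c : `|truncated c| <= \1_(box 0 N) c.
Proof. by rewrite /truncated normrM f1 mul1r ger0_norm// indicE. Qed.

Local Notation J := (`[0, 2 * pi[%classic : set RT).

(** Both the plane and the angle are cut off, so that the function is dominated by the indicator of
    a product of finite measure, as the Fubini lemmas above require. *)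
Definition circle_slice x (z : (RT * RT) * RT) : R :=
  truncated (translate R (rotation R z.2 x) z.1) * \1_J z.2.

Lemma measurable_circle_slice x : measurable_fun setT (circle_slice x).
Proof.
have m2 : measurable_fun setT (fun z : (RT * RT) * RT => z.2) by exact: measurable_snd.
have mc : measurable_fun setT (fun z : (RT * RT) * RT => cos z.2).
  exact: (measurableT_comp (measurable_cos R) m2).
have ms : measurable_fun setT (fun z : (RT * RT) * RT => sin z.2).
  exact: (measurableT_comp (measurable_sin R) m2).
have m1 : measurable_fun setT (fun z : (RT * RT) * RT => z.1) by exact: measurable_fst.
have m11 : measurable_fun setT (fun z : (RT * RT) * RT => z.1.1 : RT).
  exact: (measurableT_comp measurable_fst m1).
have m12 : measurable_fun setT (fun z : (RT * RT) * RT => z.1.2 : RT).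
  exact: (measurableT_comp measurable_snd m1).
apply: measurable_funM; last first.
  by apply: (measurableT_comp _ m2); exact: measurable_indic.
apply: (measurableT_comp measurable_truncated); apply: measurable_fun_pair => /=.
  apply: measurable_funD => //; apply: measurable_funB; exact: measurable_funM.
by apply: measurable_funD => //; apply: measurable_funD; exact: measurable_funM.
Qed.

Lemma circle_slice_bound x r : norm1 R x <= r ->
  forall c s, `|circle_slice x (c, s)| <= \1_(box (- r) (N + r)) c * \1_J s.
Proof.
move=> xr c s; rewrite /circle_slice normrM [X in _ * X]ger0_norm ?indicE//=.
apply: ler_wpM2r => //; apply: (le_trans (truncated_bound _)).
have [/boxP /= [h1 h2]|nB] :=
  pselect (box 0 N (translate R (rotation R s x) c)); last first.
  by rewrite indic_notin// indicE.
rewrite indic_in; last exact/boxP.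
rewrite -indicE indic_in//; apply/boxP.
have [r1 r2] := rotation_bound R s x.
have {}r1 := le_trans r1 xr; have {}r2 := le_trans r2 xr.
by move: r1 r2 h1 h2; rewrite !ler_norml /rotation /=; split; lra.
Qed.

Lemma integral_circle_slice x c :
  \int[mu]_s circle_slice x (c, s) =
  \int[mu]_(s in J) truncated (translate R (rotation R s x) c).
Proof.
rewrite [RHS]Rintegral_mkcond; apply: eq_Rintegral => s _.
rewrite /circle_slice /patch indicE.
by case: (_ \in _); rewrite ?mulr1 ?mulr0.
Qed.

Lemma integral_circle_slice_bound x c :
  `|\int[mu]_s circle_slice x (c, s)| <= 2 * pi.
Proof.
have pi0 := pi_gt0 R.
have mJ : measurable J by [].
have mS := measurable_circle_slice x.
have iS : mu.-integrable setT (EFin \o (fun s => circle_slice x (c, s))).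
  apply: (integrable_indic_bounded R _ _ _ _ J) => //; first exact: lebesgue_itvco_lty.
    exact: (measurable_fun_pair2 _ mS).
  move=> s; apply: (le_trans (circle_slice_bound x _ (lexx _) c s)).
  by rewrite !indicE; do 2 case: (_ \in _); rewrite ?mulr1 ?mulr0.
apply: (le_trans (le_normr_Rintegral _ iS)) => //.
have iJ : mu.-integrable setT (EFin \o (\1_J : RT -> R)).
  apply: (integrable_indic_bounded R _ _ _ _ J) => //; first exact: lebesgue_itvco_lty.
  by move=> s; rewrite ger0_norm// indicE.
apply: (@le_trans _ _ (\int[mu]_s (\1_J s : R))).
  apply: le_Rintegral => //; first exact: integrable_norm.
  move=> s _ /=; apply: (le_trans (circle_slice_bound x _ (lexx _) c s)).
  by rewrite !indicE; do 2 case: (_ \in _); rewrite ?mulr1 ?mulr0.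
rewrite /Rintegral integral_indic// setIT.
have muJ : mu J = (2 * pi)%:E.
  by rewrite lebesgue_measure_itv/= lte_fin ifT ?mulr_gt0// oppr0 adde0.
by rewrite [X in fine X]muJ.
Qed.

(** The cut-off is felt only at centres within [r] of the boundary of the square. On this frame, of
    area (N + 2r)^2 - (N - 2r)^2 = 8 N r, the trivial bound [2 * pi] is used. *)
Lemma integral_sqr_circle_slice_le x r M : norm1 R x <= r -> 2 * r <= N -> 0 <= M ->
  (forall c, (\int[mu]_(s in J) f (translate R (rotation R s x) c)) ^+ 2 <= M) ->
  (\int[leb2]_c ((\int[mu]_s circle_slice x (c, s)) ^+ 2)%:E <=
   (M * N ^+ 2 + (2 * pi) ^+ 2 * (8 * N * r))%:E)%E.
Proof.
move=> xr rN M0 fM; have pi0 := pi_gt0 R.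
set K : R := (2 * pi) ^+ 2.
have K0 : 0 <= K by exact: sqr_ge0.
have r0 : 0 <= r by apply: le_trans xr; rewrite /norm1 addr_ge0.
pose D c := \int[mu]_s circle_slice x (c, s).
have mD : measurable_fun setT (fun c : RT * RT => D c ^+ 2).
  apply: measurable_funX.
  exact: (measurable_integral_slice R _ _ leb2 _ J (measurable_box _ _) _
    (leb2_box_lty _ _) (lebesgue_itvco_lty R 0 (2 * pi)) _
    (measurable_circle_slice x) (circle_slice_bound x r xr)).
have DK c : D c ^+ 2 <= K.
  rewrite -[D c ^+ 2]real_normK ?num_real// /K lerXn2r ?nnegrE//.
    by rewrite mulr_ge0// ltW.
  exact: integral_circle_slice_bound.
(* Circles with centre in the inner box lie in the square, those with centre
   outside the outer box do not meet it. *)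
have key c : D c ^+ 2 + K * \1_(box r (N - r)) c <=
    M * \1_(box 0 N) c + K * \1_(box (- r) (N + r)) c.
  have rotr s : `|(rotation R s x).1| <= r /\ `|(rotation R s x).2| <= r.
    by have [r1 r2] := rotation_bound R s x; split; exact: le_trans xr.
  have [inn|ninn] := pselect (box r (N - r) c).
    have /boxP[i1 i2] := inn.
    rewrite (indic_in _ (box r _))// (indic_in _ (box 0 _));
      last by apply/boxP; split; lra.
    rewrite (indic_in _ (box (- r) _)); last by apply/boxP; split; lra.
    rewrite !mulr1 lerD2r.
    rewrite /D integral_circle_slice (le_trans _ (fM c))// le_eqVlt; apply/orP; left.
    apply/eqP; congr (_ ^+ 2); apply: eq_Rintegral => s _.
    rewrite /truncated indic_in ?mulr1//; apply/boxP.
    have [] := rotr s; rewrite !ler_norml /translate/= => /andP[? ?] /andP[? ?].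
    by split; lra.
  rewrite (indic_notin _ (box r _))// mulr0 addr0.
  have [out|nout] := pselect (box (- r) (N + r) c).
    rewrite (indic_in _ (box (- r) _))// mulr1.
    by rewrite (le_trans (DK c))// lerDr mulr_ge0.
  have D0 : D c = 0.
    rewrite /D integral_circle_slice (_ : (fun s => _) = cst 0).
      by rewrite Rintegral_cst// mul0r.
    apply/funext => s /=; rewrite /truncated indic_notin ?mulr0// => /boxP.
    have [] := rotr s; rewrite !ler_norml /translate/= => /andP[? ?] /andP[? ?] [? ?].
    by apply: nout; apply/boxP; split; lra.
  by rewrite D0 expr0n/= addr_ge0// mulr_ge0.
have iE a b q : 0 <= q -> a <= b ->
    (\int[leb2]_c (q * \1_(box a b) c)%:E = (q * (b - a) ^+ 2)%:E)%E.
  move=> q0 ab; under eq_integral do rewrite EFinM.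
  rewrite ge0_integralZl_EFin//; last first.
    by apply/measurable_EFinP; apply: measurable_indic; exact: measurable_box.
  rewrite integral_indic ?setIT//; last exact: measurable_box.
  by rewrite [X in (_ * X)%E]leb2_box// EFinM.
have mI q a b : measurable_fun setT (fun c : RT * RT => (q * \1_(box a b) c)%:E).
  apply/measurable_EFinP; apply: measurable_funM => //.
  by apply: measurable_indic; exact: measurable_box.
(* The inner box is added on the left instead of subtracted on the right, which keeps all integrands
   nonnegative. *)
have : (\int[leb2]_c ((D c ^+ 2)%:E + (K * \1_(box r (N - r)) c)%:E) <=
  \int[leb2]_c ((M * \1_(box 0 N) c)%:E + (K * \1_(box (- r) (N + r)) c)%:E))%E.
  apply: ge0_le_integral => //.
  - by move=> c _; rewrite adde_ge0// lee_fin ?sqr_ge0// mulr_ge0.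
  - by apply: emeasurable_funD => //; exact/measurable_EFinP.
  - exact: emeasurable_funD.
  - by move=> c _; rewrite -!EFinD lee_fin.
rewrite !ge0_integralD//; last first.
all: try by move=> c _; rewrite lee_fin ?sqr_ge0// mulr_ge0.
all: try exact/measurable_EFinP.
rewrite !iE//; last 3 first.
- by lra.
- by lra.
- by lra.
rewrite -EFinD -leeBrDr// -EFinB => /le_trans; apply.
rewrite lee_fin.
by move: K K0 {DK key iE} => K K0; lra.
Qed.

End truncation.

(** * Lower bound from the middle halves of cells *)

Section lower_bound.
Variable R : realType.
Local Notation mu := (@lebesgue_measure R).
Local Notation RT := (measurableTypeR R).
Local Notation leb2 := (leb2 R).

(** A displacement by at most 1/4 from here stays in [i, i + 1[; the open right end matches that of
    the cells. *)
Definition midcell (i : nat) : set RT := `[i%:R + 4^-1, i%:R + 3 / 4[%classic.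

Definition midcells (N : nat) : set RT := \big[setU/set0]_(i < N) midcell i.

Lemma measurable_midcells N : measurable (midcells N).
Proof. by apply: bigsetU_measurable => i _; exact: measurable_itv. Qed.

Lemma midcellsP N (y : R) : midcells N y ->
  exists2 i : nat, (i < N)%N & i%:R + 4^-1 <= y < i%:R + 3 / 4.
Proof.
rewrite /midcells -bigcup_mkord => -[i /= iN].
by rewrite /midcell/= in_itv/= => yi; exists i.
Qed.

Lemma trivIset_midcell : trivIset setT midcell.
Proof.
apply/trivIsetP => i j _ _ ij; apply/seteqP; split => // y.
rewrite /midcell /= !in_itv/= => -[yi yj].
wlog ltij : i j ij yi yj / (i < j)%N.
  move=> H; move: (ij); rewrite neq_ltn => /orP[]; first exact: H.
  by apply: H => //; rewrite eq_sym.
have : (i.+1%:R <= j%:R :> R) by rewrite ler_nat.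
by rewrite -natr1; lra.
Qed.

Lemma lebesgue_midcell i : mu (midcell i) = (2^-1)%:E.
Proof.
rewrite /midcell lebesgue_measure_itv/= lte_fin ifT; last by lra.
by rewrite -EFinB; congr (_%:E); lra.
Qed.

Lemma lebesgue_midcells N : mu (midcells N) = (N%:R / 2)%:E.
Proof.
rewrite /midcells measure_bigsetU;
  [|by move=> i; exact: measurable_itv|exact: trivIset_midcell].
rewrite (eq_bigr (fun=> (2^-1)%:E)); last first.
  by move=> i _; exact: lebesgue_midcell.
by rewrite sumEFin sumr_const card_ord mulr_natl.
Qed.

Variable f : R * R -> R.
Hypothesis f1 : forall p, f p = -1 \/ f p = 1.
Hypothesis cf : cellwise_constant f.

Lemma norm_two_valued p : `|f p| = 1.
Proof. by case: (f1 p) => ->; rewrite ?normrN normr1. Qed.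

Lemma truncated_midcell (N i j : nat) (w c : R * R) : (i < N)%N -> (j < N)%N ->
  i%:R + 4^-1 <= c.1 < i%:R + 3 / 4 -> j%:R + 4^-1 <= c.2 < j%:R + 3 / 4 ->
  `|w.1| <= 4^-1 -> `|w.2| <= 4^-1 ->
  truncated R f N%:R (translate R w c) = f (i%:R, j%:R).
Proof.
move=> iN jN ci cj; rewrite !ler_norml => w1 w2.
have i0 : (0 <= i%:R :> R) by rewrite ler0n.
have j0 : (0 <= j%:R :> R) by rewrite ler0n.
have iN' : (i%:R + 1 <= N%:R :> R) by rewrite natr1 ler_nat.
have jN' : (j%:R + 1 <= N%:R :> R) by rewrite natr1 ler_nat.
rewrite /truncated indic_in ?mulr1; last by apply/boxP; rewrite /translate/=; split; lra.
apply: (cf i%:Z j%:Z); rewrite /unit_cell/translate/=; apply/andP; split; lra.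
Qed.

(** When c is in the middle half of a cell of the square, all displaced points share that cell, so
    the terms are equal signs and the square of their sum is exactly [#|U|%:R ^+ 2]. Such c fill an
    area (N / 2)^2. *)
Lemma integral_sqr_sum_ge (U : finType) (N : nat) (w : U -> R * R) :
  (forall u, `|(w u).1| <= 4^-1 /\ `|(w u).2| <= 4^-1) ->
  ((#|U|%:R ^+ 2 * (N%:R / 2) ^+ 2)%:E <=
   \int[leb2]_c ((\sum_(u : U) truncated R f N%:R (translate R (w u) c)) ^+ 2)%:E)%E.
Proof.
move=> w4.
have mf := cellwise_constant_measurable R f cf.
pose A := midcells N `*` midcells N.
have mA : measurable A by apply: measurableX; exact: measurable_midcells.
have -> : ((#|U|%:R ^+ 2 * (N%:R / 2) ^+ 2)%:E =
    \int[leb2]_c (#|U|%:R ^+ 2 * \1_A c)%:E)%E.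
  under eq_integral do rewrite EFinM.
  rewrite ge0_integralZl_EFin ?sqr_ge0//; last first.
    by apply/measurable_EFinP; exact: measurable_indic.
  rewrite integral_indic// setIT.
  have leb2A : (leb2 A = (N%:R / 2)%:E * (N%:R / 2)%:E)%E.
    by rewrite leb2E ?lebesgue_midcells//; exact: measurable_midcells.
  by rewrite [X in (_ * X)%E]leb2A -!EFinM -expr2.
apply: ge0_le_integral => //.
- apply/measurable_EFinP; apply: measurable_funM; first exact: measurable_cst.
  exact: measurable_indic.
- apply/measurable_EFinP; apply: measurable_funX; apply: measurable_sum => u.
  exact: (measurableT_comp (measurable_truncated R f mf _) (measurable_translate R _)).
move=> c _; rewrite lee_fin.
have [[/= /midcellsP[i iN ci] /midcellsP[j jN cj]]|nA] := pselect (A c); last first.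
  by rewrite indic_notin// mulr0 sqr_ge0.
rewrite (eq_bigr (fun=> f (i%:R, j%:R))); last first.
  by move=> u _; have [w1 w2] := w4 u; exact: truncated_midcell.
rewrite sumr_const -[f _ *+ _]mulr_natl exprMn (_ : f _ ^+ 2 = 1) ?mulr1.
  by rewrite ler_piMr ?sqr_ge0// indicE; case: (_ \in _).
by case: (f1 (i%:R, j%:R)) => ->; rewrite ?sqrrN expr1n.
Qed.

(** A one-sided band t in [s, s + e[ with s in [0, 1[: for e <= 1 both angles stay below 2, hence in
    [0, 2 pi[, and each nonempty section at fixed s has length e. *)
Definition diagonal_band (e : R) : set (RT * RT) :=
  (fun z : RT * RT => (z.1, (z.2 : R) - z.1) : RT * RT) @^-1`
    (`[0, 1[%classic `*` `[0, e[%classic).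

Lemma measurable_diagonal_band e : measurable (diagonal_band e).
Proof.
rewrite /diagonal_band -[X in measurable X]setTI.
have mphi : measurable_fun setT (fun z : RT * RT => (z.1, (z.2 : R) - z.1) : RT * RT).
  by apply: measurable_fun_pair => //; apply: measurable_funB.
by apply: mphi => //; apply: measurableX.
Qed.

Lemma leb2_diagonal_band e : 0 <= e -> leb2 (diagonal_band e) = e%:E.
Proof.
move=> e0.
rewrite -[LHS]/(\int[mu]_s mu (xsection (diagonal_band e) s))%E.
rewrite (eq_integral (fun s : RT => (e * \1_(`[0, 1[%classic : set RT) s)%:E)).
  under eq_integral do rewrite EFinM.
  rewrite ge0_integralZl_EFin//; last by apply/measurable_EFinP; exact: measurable_indic.
  have mu01 : mu `[0, 1[%classic = 1%E.
    by rewrite lebesgue_measure_itv/= lte_fin ltr01 oppr0 adde0.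
  by rewrite integral_indic// setIT [X in (_ * X)%E]mu01 mule1.
move=> s _.
have [s01|ns] := pselect ((`[0, 1[%classic : set RT) s); last first.
  rewrite indic_notin// mulr0 (_ : xsection _ _ = set0) ?measure0//.
  by apply/seteqP; split => // t; rewrite /xsection/= inE => -[].
rewrite indic_in// mulr1 (_ : xsection _ _ = `[s : R, (s : R) + e[%classic).
  rewrite lebesgue_measure_itv/= lte_fin ltrDl.
  move: e0; rewrite le_eqVlt => /predU1P[<-|->]; first by rewrite ltxx.
  by rewrite -EFinB addrAC subrr add0r.
apply/seteqP; split => t; rewrite /xsection/= inE /diagonal_band/= !in_itv/=.
  by move=> [_]; rewrite subr_ge0 ltrBlDl.
move=> st; split; first by move: s01; rewrite /= in_itv.
by rewrite subr_ge0 ltrBlDl.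
Qed.

End lower_bound.

(** * The two bounds for the mean square over the grid *)

Section mean_square.
Variable R : realType.
Local Notation mu := (@lebesgue_measure R).
Local Notation RT := (measurableTypeR R).
Local Notation leb2 := (leb2 R).
Local Notation J := (`[0, 2 * pi[%classic : set RT).
Variable f : R * R -> R.
Hypothesis f1 : forall p, f p = -1 \/ f p = 1.
Hypothesis cf : cellwise_constant f.
Variables (n N : nat) (h : R).
Hypothesis h0 : 0 < h.
Local Notation U := ('I_n * 'I_n)%type.

Definition grid (u : U) : R * R := (h * (u.1 : nat)%:R, h * (u.2 : nat)%:R).

Lemma norm1_grid u : norm1 R (grid u) <= 2 * h * n%:R.
Proof.
have lt_n (i : 'I_n) : `|h * (i : nat)%:R| <= h * n%:R.
  rewrite ger0_norm; last by rewrite mulr_ge0// ltW.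
  by rewrite ler_pM2l// ler_nat ltnW.
by rewrite /norm1 /= -mulrA mulr_natl mulr2n lerD.
Qed.

Lemma norm1_gridB u v : norm1 R (grid v - grid u) <= 2 * h * n%:R.
Proof.
have lt_n (i j : 'I_n) : `|h * (i : nat)%:R - h * (j : nat)%:R| <= h * n%:R.
  rewrite -mulrBr normrM gtr0_norm// ler_pM2l// ler_norml.
  have := ltn_ord i; have := ltn_ord j; rewrite -!(ltr_nat R) => jn iN.
  have i0 : 0 <= (i : nat)%:R :> R by [].
  have j0 : 0 <= (j : nat)%:R :> R by [].
  by lra.
by rewrite /norm1 /= -mulrA mulr_natl mulr2n lerD.
Qed.

(* Only the angles in [diagonal_band e] contribute to the lower bound; all others
   give a nonnegative amount by [sum_correlation]. *)
Lemma mean_square_discrepancy (e : R) (M : U * U -> R) :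
  0 <= e <= 1 -> e * (2 * h * n%:R) <= 4^-1 -> 2 * (2 * h * n%:R) <= N%:R ->
  (forall i, 0 <= M i) ->
  (forall i c, (\int[mu]_(s in J)
     f (translate R (rotation R s (grid i.2 - grid i.1)) c)) ^+ 2 <= M i) ->
  (n%:R ^+ 2) ^+ 2 * (N%:R / 2) ^+ 2 * e <=
  \sum_i (M i * N%:R ^+ 2 + (2 * pi) ^+ 2 * (8 * N%:R * (2 * h * n%:R))).
Proof.
move=> /andP[e0 e1] en nN M0 fM.
have pi2 := pi_ge2 R.
have mf := cellwise_constant_measurable R f cf.
have nf := norm_two_valued R f f1.
rewrite -lee_fin -sumEFin EFinM -(leb2_diagonal_band R e e0).
pose G (i : U * U) := circle_slice R f N%:R (grid i.2 - grid i.1).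
(* The total mean square is the middle term: above it, each pair of grid points is estimated
   separately; below it, the sum over all pairs is taken at fixed angles. *)
apply: (@le_trans _ _
  (\sum_i \int[leb2]_c ((\int[mu]_s G i (c, s)) ^+ 2)%:E)%E); last first.
  apply: lee_sum => i _.
  apply: (integral_sqr_circle_slice_le R f mf nf N%:R _ _ _ (norm1_gridB _ _)) => //.
apply: (sum_sqr_integral_ge R _ _ leb2
  (box R (- (2 * h * n%:R)) (N%:R + 2 * h * n%:R)) J) => //.
- exact: measurable_box.
- exact: leb2_box_lty.
- exact: lebesgue_itvco_lty.
- by move=> i; exact: measurable_circle_slice.
- by move=> i; apply: circle_slice_bound => //; exact: norm1_gridB.
- exact: measurable_diagonal_band.
move=> [s t] /=.
(* If an angle lies outside [J], all correlations vanish, and so does the indicator of the band. *)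
have [[sJ tJ]|nJ] := pselect (J s /\ J t); last first.
  have nW : ~ diagonal_band R e (s, t).
    rewrite /diagonal_band/= !in_itv/= => -[/andP[s0 s1] /andP[st0 st1]].
    by apply: nJ; rewrite /= !in_itv/=; split; apply/andP; split; lra.
  rewrite indic_notin// mulr0 big1// => i _.
  rewrite integral0_eq// => c _.
  have [sJ|nsJ] := pselect (J s); last first.
    by rewrite /G /circle_slice/= (indic_notin _ _ _ _ nsJ) mulr0 mul0r.
  have ntJ : ~ J t by move=> tJ; exact: nJ.
  by rewrite /G /circle_slice/= (indic_notin _ _ _ _ ntJ) !mulr0.
under eq_bigr => i _.
  under eq_integral => c _.
    rewrite /G /circle_slice/= (indic_in _ _ _ _ sJ) (indic_in _ _ _ _ tJ) !mulr1.
    rewrite !rotationB.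
    over.
  over.
rewrite (sum_correlation R _ (truncated R f N%:R) (box R 0 N%:R)
  (fun u => rotation R s (grid u)) (fun u => rotation R t (grid u))); last 4 first.
- exact: measurable_truncated.
- exact: measurable_box.
- exact: leb2_box_lty.
- exact: truncated_bound.
have [W|nW] := pselect (diagonal_band R e (s, t)); last first.
  rewrite indic_notin// mulr0; apply: integral_ge0 => c _.
  by rewrite lee_fin sqr_ge0.
rewrite indic_in// mulr1.
have := integral_sqr_sum_ge R f f1 cf _ N
  (fun u => rotation R t (grid u) - rotation R s (grid u)).
rewrite card_prod card_ord natrM -expr2; apply => u.
have [w1 w2] := rotationB_bound R t s (grid u).
(* The width [e] of the band is chosen so that every grid point moves by at most 1/4 between the two
   angles. *)
have ts : `|t - s| * norm1 R (grid u) <= 4^-1.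
  apply: le_trans en; apply: ler_pM => //; last exact: norm1_grid.
    by rewrite /norm1 addr_ge0.
  move: W; rewrite /diagonal_band/= !in_itv/= => -[_ /andP[st0 st1]].
  by rewrite ger0_norm// ltW.
by split; [exact: le_trans ts|exact: le_trans ts].
Qed.

End mean_square.

(** * Choice of parameters and the contradiction *)

(** Here a = n, b = N, K = (2 pi)^2 and S is the sum of the bounds on squares. After division by b^2
    the boundary term is at most a^2 K, since b > 16 h a^3. In units of a^3 / h, the two terms a^2 K
    cost less than 1/50, as 100 h K < a, and the rest is 12/1600; together this is below 1/32. *)
Lemma mean_square_contradiction (R : realFieldType) (h K a b S : R) :
  0 < h -> 0 < K -> 1 <= a -> 16 * h * a ^+ 3 < b -> 100 * h * K < a ->
  S <= a ^+ 2 * K + 40^-1 ^+ 2 / h * (12 * a ^+ 3) ->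
  S * b ^+ 2 + a ^+ 4 * (K * (8 * b * (2 * h * a))) <
  a ^+ 2 ^+ 2 * (b / 2) ^+ 2 * (8 * h * a)^-1.
Proof.
move=> h0 K0 a1 bE aK SE.
have a0 : 0 < a by lra.
have b0 : 0 < b by apply: lt_trans bE; rewrite !mulr_gt0 ?exprn_gt0.
have edge : a ^+ 4 * (K * (8 * b * (2 * h * a))) <= a ^+ 2 * K * b ^+ 2.
  rewrite (_ : a ^+ 4 * _ = a ^+ 2 * K * b * (16 * h * a ^+ 3)); last by ring.
  rewrite [b ^+ 2]expr2 [leRHS]mulrA ler_pM2l; first exact: ltW.
  by rewrite !mulr_gt0 ?exprn_gt0.
have diag : S * b ^+ 2 <= (a ^+ 2 * K + 40^-1 ^+ 2 / h * (12 * a ^+ 3)) * b ^+ 2.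
  by rewrite ler_pM2r ?exprn_gt0.
apply: le_lt_trans (lerD diag edge) _.
rewrite -mulrDl.
rewrite (_ : a ^+ 2 ^+ 2 * _ * _ = (a ^+ 3 / (32 * h)) * b ^+ 2); last first.
  by field; rewrite !gt_eqF.
rewrite ltr_pM2r ?exprn_gt0//.
rewrite (_ : _ + _ + _ = (a ^+ 2 / h) * (2 * (h * K) + 12 * 40^-1 ^+ 2 * a)); last first.
  by field; rewrite gt_eqF.
rewrite (_ : a ^+ 3 / _ = (a ^+ 2 / h) * (a / 32)); last by field; rewrite gt_eqF.
rewrite ltr_pM2l ?divr_gt0 ?exprn_gt0//.
have : 0 < h * K by rewrite mulr_gt0.
by move: aK; rewrite -mulrA; lra.
Qed.

(** The n^2 diagonal pairs give [K] each; the nonnegative inverse distances may then be summed over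
    all pairs. *)
Lemma sum_diagonal_le (R : realType) (n : nat) (K a : R) : 0 <= a -> 0 <= K ->
  \sum_(i : ('I_n * 'I_n) * ('I_n * 'I_n))
    (if i.1 == i.2 then K
     else a * (maxn (gap i.1.1 i.2.1) (gap i.1.2 i.2.2))%:R^-1) <=
  n%:R ^+ 2 * K + a * (12 * n%:R ^+ 3).
Proof.
move=> a0 K0.
pose g (i : ('I_n * 'I_n) * ('I_n * 'I_n)) : R :=
  (maxn (gap i.1.1 i.2.1) (gap i.1.2 i.2.2))%:R^-1.
apply: (@le_trans _ _ (\sum_i ((i.1 == i.2)%:R * K + a * g i))).
  apply: ler_sum => i _; case: eqP => _.
    by rewrite mul1r lerDl mulr_ge0// invr_ge0.
  by rewrite mul0r add0r.
rewrite big_split/= -mulr_sumr lerD//; last by rewrite ler_wpM2l// sum_pairs_inv_gap_le.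
rewrite -mulr_suml ler_wpM2r//.
rewrite -(pair_bigA _ (fun u v : 'I_n * 'I_n => (u == v)%:R : R))/=.
rewrite (eq_bigr (fun=> 1)); last first.
  move=> u _; rewrite (bigD1 u)//= eqxx big1 ?addr0// => v vu.
  by rewrite eq_sym (negbTE vu).
by rewrite sumr_const card_prod card_ord natrM expr2.
Qed.

(** The Euclidean norm dominates the maximum norm, for which [sum_pairs_inv_gap_le] sums the
    inverses. *)
Lemma norm_grid_ge (R : realType) (n : nat) (h : R) (u v : 'I_n * 'I_n) : 0 < h ->
  h * (maxn (gap u.1 v.1) (gap u.2 v.2))%:R <=
  Num.sqrt ((grid R n h v - grid R n h u).1 ^+ 2 +
            (grid R n h v - grid R n h u).2 ^+ 2).
Proof.
move=> h0; set x := _ - _.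
have x1 : h * (gap u.1 v.1)%:R = `|x.1|.
  by rewrite -natr_gap distrC -{1}(gtr0_norm h0) -normrM mulrBr.
have x2 : h * (gap u.2 v.2)%:R = `|x.2|.
  by rewrite -natr_gap distrC -{1}(gtr0_norm h0) -normrM mulrBr.
have sq (y z : R) : 0 <= z -> `|y| <= Num.sqrt (y ^+ 2 + z).
  by move=> z0; rewrite -sqrtr_sqr ler_wsqrtr// lerDl.
rewrite /maxn; case: ifP => _; last by rewrite x1 sq ?sqr_ge0.
by rewrite x2 addrC sq ?sqr_ge0.
Qed.

Lemma grid_inj (R : realType) (n : nat) (h : R) : 0 < h -> injective (grid R n h).
Proof.
move=> h0 [u1 u2] [v1 v2] [].
move=> /(mulfI (lt0r_neq0 h0))/eqP; rewrite eqr_nat => /eqP/val_inj ->.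
by move=> /(mulfI (lt0r_neq0 h0))/eqP; rewrite eqr_nat => /eqP/val_inj ->.
Qed.

Theorem theorem1 (R : realType) :
  exists2 C : R, 0 < C &
    forall f : R * R -> R,
      (forall p, f p = -1 \/ f p = 1) ->
      cellwise_constant f ->
      forall R0 : R, 0 < R0 ->
      exists2 r : R, R0 < r &
      exists (c : R * R) (I : set (R * R)),
        circular_arc c r I /\
        C * Num.sqrt r <= `| arc_integral c r I f |.
Proof.
(* With C = 1/40, the off-diagonal contribution 12 C^2 leaves room below the constant 1/32 of the
   lower bound, as [mean_square_contradiction] requires. *)
exists 40^-1 => // f f1 cf R0 R00; apply: contrapT => nex.
have arc_lt r c : R0 < r -> `|arc_integral c r (circle c r) f| < 40^-1 * Num.sqrt r.
  move=> Rr; rewrite ltNge; apply/negP => le_arc; apply: nex; exists r => //.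
  exists c, (circle c r); split => //; apply: circular_arc_circle.
  exact: lt_trans Rr.
have mf := cellwise_constant_measurable R f cf.
have nf p : `|f p| <= 1 by rewrite (norm_two_valued R f f1).
have pi2 := pi_ge2 R.
(* The spacing exceeds [R0], so [arc_lt] covers all circles coming from distinct grid points. *)
pose h : R := R0 + 1; pose K : R := (2 * pi) ^+ 2.
have h0 : 0 < h by rewrite /h; lra.
have K0 : 0 < K by rewrite exprn_gt0// mulr_gt0// pi_gt0.
have [C2 C2E] : exists C2 : R, C2 = 40^-1 ^+ 2 by exists (40^-1 ^+ 2).
have C20 : 0 <= C2 by rewrite C2E sqr_ge0.
(* A large grid makes the n^2 diagonal pairs negligible against n^3 / h. *)
have [n nK] : exists n : nat, 100 * h * K < n%:R.
  exists (Num.bound (100 * h * K)); apply: archi_boundP.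
  by rewrite mulr_ge0 ?(ltW K0)// mulr_ge0 ?(ltW h0).
have n1 : 1 <= n%:R :> R.
  by rewrite ler1n -(ltr_nat R); apply: le_lt_trans nK;
    rewrite mulr_ge0 ?(ltW K0)// mulr_ge0 ?(ltW h0).
(* A large square makes the boundary terms of all n^4 pairs negligible. *)
have [N NE] : exists N : nat, 16 * h * n%:R ^+ 3 < N%:R.
  exists (Num.bound (16 * h * n%:R ^+ 3)); apply: archi_boundP.
  by rewrite mulr_ge0 ?exprn_ge0// mulr_ge0 ?(ltW h0).
have n31 : n%:R <= n%:R ^+ 3 :> R by rewrite -[leLHS]expr1 ler_weXn2l.
(* On the diagonal the circle degenerates to its centre: the integrand is the constant [f c], and
   the square of its integral is [K]. *)
pose M (i : ('I_n * 'I_n) * ('I_n * 'I_n)) : R := if i.1 == i.2 then K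
  else C2 / h * (maxn (gap i.1.1 i.2.1) (gap i.1.2 i.2.2))%:R^-1.
pose e : R := (8 * h * n%:R)^-1.
have hn0 : 0 < 8 * h * n%:R by rewrite !mulr_gt0//; lra.
have en : e * (2 * h * n%:R) = 4^-1 by rewrite /e; field; rewrite gt_eqF//; lra.
have M0 i : 0 <= M i.
  by rewrite /M; case: ifP => _; [exact: ltW|rewrite mulr_ge0 ?invr_ge0// divr_ge0// ltW].
have fM i c : (\int[lebesgue_measure]_(s in `[0, 2 * pi[)
     f (translate R (rotation R s (grid R n h i.2 - grid R n h i.1)) c)) ^+ 2 <= M i.
  set x := grid R n h i.2 - grid R n h i.1.
  rewrite /M; case: eqP => [iE|/eqP ine].
    rewrite (@eq_Rintegral _ _ _ _ _ (cst (f c))); last first.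
      move=> s _; rewrite /x iE subrr /rotation /translate/=.
      by rewrite !mul0r subr0 !addr0 -surjective_pairing.
    rewrite Rintegral_cst//= exprMn.
    rewrite -[f c ^+ 2]real_normK ?num_real// (norm_two_valued R f f1) expr1n mul1r.
    rewrite lebesgue_measure_itv/= lte_fin ifT ?mulr_gt0 ?pi_gt0//.
    by rewrite oppr0 adde0.
  have x0 : x != 0.
    by rewrite subr_eq0; apply: contra ine => /eqP/(grid_inj R n h h0) ->.
  have [r0 ->] := rotation_integral_arc R f mf nf x c x0.
  set r := Num.sqrt _ in r0 *.
  have rh : h * (maxn (gap i.1.1 i.2.1) (gap i.1.2 i.2.2))%:R <= r.
    exact: norm_grid_ge.
  have g1 : (0 < maxn (gap i.1.1 i.2.1) (gap i.1.2 i.2.2))%N.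
    rewrite leq_max !lt0n !gap_eq0; move: ine.
    case: (i.1) (i.2) => [u1 u2] [v1 v2] /=.
    by rewrite xpair_eqE negb_and.
  have Rr : R0 < r.
    apply: lt_le_trans rh; apply: (@lt_le_trans _ _ h); first by rewrite /h ltrDl.
    by rewrite ler_peMr ?ler1n// ltW.
  have := arc_lt r c Rr; set A := arc_integral _ _ _ _ => Alt.
  have A2 : A ^+ 2 <= C2 * r.
    rewrite -real_normK ?num_real// C2E -[in leRHS](sqr_sqrtr (ltW r0)) -exprMn.
    by rewrite lerXn2r ?nnegrE ?mulr_ge0 ?invr_ge0 ?sqrtr_ge0 ?ler0n// ltW.
  rewrite exprMn exprVn.
  (* The factor [r^-1] from the change to angles, once squared, turns [C2 * r] into [C2 / r]; then
     [rh] replaces [r] by the grid distance. *)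
  apply: (@le_trans _ _ (C2 / r)); last first.
    rewrite -mulrA ler_wpM2l// -invfM lef_pV2 ?posrE//.
    by rewrite mulr_gt0// ltr0n.
  rewrite ler_pdivrMl ?exprn_gt0//; apply: (le_trans A2).
  by rewrite (_ : r ^+ 2 * _ = C2 * r)//; field; rewrite gt_eqF.
have hn : h <= h * n%:R by rewrite ler_peMr// ltW.
have e1 : 0 <= e <= 1.
  by rewrite /e invr_ge0 (ltW hn0) invf_le1//=; move: hn; rewrite /h; lra.
have hn3 : h * n%:R <= h * n%:R ^+ 3 by rewrite ler_pM2l.
have nN : 2 * (2 * h * n%:R) <= N%:R by lra.
have := mean_square_discrepancy R f f1 cf n N h h0 e M e1 _ nN M0 fM.
rewrite en lexx => /(_ isT).
have sum_cst (y : R) :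
    \sum_(i : ('I_n * 'I_n) * ('I_n * 'I_n)) y = n%:R ^+ 4 * y.
  by rewrite sumr_const !card_prod !card_ord -[LHS]mulr_natl !natrM; congr (_ * y); ring.
rewrite big_split/= -mulr_suml sum_cst -/K.
apply/negP; rewrite -ltNge.
apply: (mean_square_contradiction _ h K _ _ _ h0 K0 n1 NE nK).
rewrite -C2E.
exact: (sum_diagonal_le R n K (C2 / h) (divr_ge0 C20 (ltW h0)) (ltW K0)).
Qed.
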